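(* Let $G$ be a simple graph and let $m,n\in\mathbb{Z}^+$ with $m\mid n$. If $\chi_m(G)$ exists, then \[ \chi(G) \leq \chi_n(G) \leq \chi_m(G). \]
   Context: Graphs are simple (possibly infinite) graphs $G=(V,E)$. A $\mathbb{Z}$-labeling (coloring) of $G$ is a map $\ell:V\to\mathbb{Z}$; its order $|\ell|$ is the size of its range. It is proper if adjacent vertices get different labels; $\chi(G)$ is the minimum order of a proper labeling. $N[v]$ denotes the closed neighborhood of $v$ (i.e. $v$ together with all its neighbors). For $n\in\mathbb{Z}^+$, a closed coloring with nonzero remainders mod $n$ is a labeling $\ell$ with $\sum_{w\in N[v]}\ell(w)\not\equiv 0 \pmod n$ for every $v\in V$. If no proper such coloring exists, $\chi_n(G)$ is said not to exist; if proper such colorings of finite order exist, $\chi_n(G)$ is the minimum order of a proper closed coloring with nonzero remainders mod $n$; if they exist only of infinite order, $\chi_n(G)=\infty$. *)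

(* Defs.v *)
From HB Require Import structures.
From mathcomp Require Import all_boot all_order all_algebra finmap.
From mathcomp Require Import boolp classical_sets functions cardinality fsbigop.
From mathcomp Require Import constructive_ereal.

Set Implicit Arguments.
Unset Strict Implicit.
Unset Printing Implicit Defensive.

Import Order.TTheory GRing.Theory Num.Theory.

Local Open Scope classical_set_scope.
Local Open Scope ring_scope.

(* Classically every type carries a choiceType structure and every relation is
   boolean, so these are arbitrary, possibly infinite, simple graphs. *)
Record sgraph := SGraph {
  vertex :> choiceType;
  adj : rel vertex;
  adj_sym : symmetric adj;
  adj_irr : irreflexive adj }.

Definition closed_nbhd (G : sgraph) (v : G) : set G :=
  [set w | w = v \/ adj v w].

Definition labeling (G : sgraph) := G -> int.

(* \bar int also contains -oo, which is never a value of [label_order]. *)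
Definition label_order (G : sgraph) (l : labeling G) : \bar int :=
  if `[< finite_set (range l) >] then (#|` fset_set (range l)|%:Z)%:E
  else +oo%E.

Definition proper_labeling (G : sgraph) (l : labeling G) : Prop :=
  forall v w : G, adj v w -> l v <> l w.

(* If N[v] is infinite and l has infinite support on it, the sum is
   meaningless; \sum_(_ \in _) is then 0, so that such an l is not a closed
   coloring.  On locally finite graphs this case never occurs. *)
Definition closed_coloring (G : sgraph) (n : nat) (l : labeling G) : Prop :=
  forall v : G, (\sum_(w \in closed_nbhd v) l w != 0 %[mod n%:Z])%Z.

Definition is_min_order (G : sgraph) (P : set (labeling G)) (k : \bar int) :
    Prop :=
  (exists2 l, P l & label_order l = k) /\
  (forall l, P l -> (k <= label_order l)%E).

(* The default +oo is only reached when P is empty. *)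
Definition min_order (G : sgraph) (P : set (labeling G)) : \bar int :=
  xget +oo%E [set k | is_min_order P k].

Definition chi (G : sgraph) : \bar int := min_order (@proper_labeling G).

Definition proper_closed_coloring (G : sgraph) (n : nat) (l : labeling G) :
    Prop :=
  proper_labeling l /\ closed_coloring n l.

Definition chi_mod_exists (G : sgraph) (n : nat) : Prop :=
  exists l : labeling G, proper_closed_coloring n l.

Definition chi_mod (G : sgraph) (n : nat) : \bar int :=
  min_order (@proper_closed_coloring G n).

(* Main.v *)
(* A labeling whose closed neighborhood sums avoid 0 mod m also avoids 0 mod
   every multiple n of m, so the three quantities are minima of the same order
   function over increasingly large sets of labelings.  The minima are attained
   because orders are natural numbers or infinite. *)
Require Import Defs.
From HB Require Import structures.
From mathcomp Require Import all_boot all_order all_algebra finmap.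
From mathcomp Require Import boolp classical_sets functions cardinality fsbigop.
From mathcomp Require Import constructive_ereal.

Set Implicit Arguments.
Unset Strict Implicit.
Unset Printing Implicit Defensive.

Import Order.TTheory GRing.Theory Num.Theory.

Local Open Scope classical_set_scope.
Local Open Scope ring_scope.

(** If some labeling in [P] has finite order, well-ordering of the naturals yields the minimum;
    otherwise every order is [+oo], which any member of [P] attains. *)
Lemma is_min_order_exists (G : sgraph) (P : set (labeling G)) :
  P !=set0 -> exists k, is_min_order P k.
Proof.
move=> [l0 Pl0].
pose fin_order c := `[< exists2 l, P l & label_order l = c%:Z%:E >].
have [finP|infP] := pselect (exists c, fin_order c).
  case: (ex_minnP finP) => c /asboolP[l Pl lc] cmin.
  exists c%:Z%:E; split; first by exists l.
  move=> l' Pl'; case E: (label_order l') => [r||].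
  (* A finite value [r] can only come from the finite-range branch, so it is a cardinal and the
     minimality of [c] applies. *)
  - move: (E); rewrite /label_order; case: ifP => // _ [rE].
    by rewrite -rE lee_fin lez_nat cmin//; apply/asboolP; exists l'; rewrite ?rE.
  - by rewrite leey.
  - by move: E; rewrite /label_order; case: ifP.
have oo l : P l -> label_order l = +oo%E.
  move=> Pl; rewrite /label_order; case: ifPn => // finl; case: infP.
  exists #|` fset_set (range l)|; apply/asboolP; exists l => //.
  by rewrite /label_order finl.
exists +oo%E; split; first by exists l0 => //; exact: oo.
by move=> l /oo ->.
Qed.

Lemma min_orderP (G : sgraph) (P : set (labeling G)) :
  P !=set0 -> is_min_order P (min_order P).
Proof. by move=> /is_min_order_exists exk; exact: xgetPex exk. Qed.

Lemma min_order_subset (G : sgraph) (P Q : set (labeling G)) :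
  P !=set0 -> P `<=` Q -> (min_order Q <= min_order P)%E.
Proof.
(* A minimizer [l] for [P] also lies in [Q], so its order bounds the minimum over [Q] from above. *)
move=> P0 PQ; have [[l Pl <-] _] := min_orderP P0.
have [_] : is_min_order Q (min_order Q).
  by apply: min_orderP; exists l; exact: PQ.
by apply; exact: PQ.
Qed.

Lemma closed_coloring_dvd (G : sgraph) (m n : nat) (l : labeling G) :
  (m %| n)%N -> closed_coloring m l -> closed_coloring n l.
Proof.
move=> mn lm v; apply: contra (lm v).
(* Integer divisibility is divisibility of absolute values, so [mn] serves directly as the first
   link of the transitivity. *)
rewrite !eqz_mod_dvd; exact: dvdz_trans.
Qed.

Theorem theorem3p1 (G : sgraph) (m n : nat) (hm : (0 < m)%N) (hn : (0 < n)%N)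
    (hmn : (m %| n)%N) (hex : chi_mod_exists G m) :
  [/\ chi_mod_exists G n,
      (chi G <= chi_mod G n)%E & (chi_mod G n <= chi_mod G m)%E].
Proof.
have sub : @proper_closed_coloring G m `<=` @proper_closed_coloring G n.
  by move=> l [pl lm]; split=> //; exact: closed_coloring_dvd lm.
have exn : chi_mod_exists G n by case: hex => l /sub ln; exists l.
split=> //; first by apply: min_order_subset => // l [].
exact: min_order_subset.
Qed.
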